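(* Let $T>0$ and consider the $T$-periodic Abel equation $$x'=(a_1(t)x-1)(a_2(t)x-b_2(t))x-\frac{a_1'(t)}{a_1(t)}x,\qquad (t,x)\in\mathbb{R}^2,\tag{E}$$ with $a_1,a_2,b_2$ as described in the context, and let $V$ be the region defined in the context. Assume $b_2$ is not identically null and there exists $\eta\in\mathbb{R}$ such that one of the following two sets of conditions holds. (A) $b_2+\eta a_1'/a_1$ has positive definite sign, and for each $t\in[0,T]$: (i) if $a_1(t)<0$ then $a_2(t)\ge 0$; (ii) if $a_1(t)>0$ then $a_1(t)b_2(t)-a_2(t)+\eta a_1'(t)\ge 0$; and the inequalities in (i) and (ii) are strict for all $t\in P$, where $P$ is a subset of $[0,T]$ of positive measure. (B) $b_2+\eta a_1'/a_1$ has negative definite sign, and for each $t\in[0,T]$: (i) if $a_1(t)<0$ then $a_2(t)\le 0$; (ii) if $a_1(t)>0$ then $a_1(t)b_2(t)-a_2(t)+\eta a_1'(t)\le 0$; and the inequalities in (i) and (ii) are strict for all $t\in P$, where $P$ is a subset of $[0,T]$ of positive measure. Then equation (E) has at most one non-trivial limit cycle with graph included in $V$. Moreover, this upper bound is attained: there exist $a_1,a_2,b_2$ satisfying the hypotheses for which (E) has exactly one non-trivial limit cycle with graph included in $V$.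
   Context: Setting: $a_1$ is a smooth $T$-periodic function on $\mathbb{R}$ whose zero set has null measure. $a_2,b_2$ are $T$-periodic functions, smooth at every $t$ with $a_1(t)\ne 0$ and possibly having poles at zeros of $a_1$, with $a_2$ not identically null, such that the coefficients of $$x'=a_1a_2x^3-(a_1b_2+a_2)x^2+\Big(b_2-\frac{a_1'}{a_1}\Big)x$$ (the expanded form of equation (E)), defined where $a_1(t)\neq0$, are (extend to) smooth $T$-periodic functions on all of $\mathbb{R}$; equation (E) is understood as the equation with these extended coefficients. The curves $x=0$ and $a_1(t)x-1=0$ are invariant for (E). Conditions involving $a_2$, $b_2$ or $a_1'/a_1$ are understood at those $t$ with $a_1(t)\ne0$. Region $V\subset\mathbb{R}^2$: - if $a_1(t)>0$ for all $t$: $V=\{(t,x):0<x<1/a_1(t)\}$; - if $a_1$ has zeros: $V=\{(t,x): x>0,\text{ and } 0<x<1/a_1(t)\text{ for those } t \text{ with } a_1(t)>0\}$; - if $a_1(t)<0$ for all $t$: $V=\{(t,x): x>0 \text{ or } x<1/a_1(t)\}$. A $T$-periodic function $f$ has positive (resp. negative) definite sign if $f(t)\ge0$ (resp. $f(t)\le 0$) for all $t\in[0,T]$. Let $u(t,x)$ be the solution with $u(0,x)=x$. It is periodic if $u(T,x)=x$; a limit cycle is a periodic solution that is isolated in the set of all periodic solutions. ''Non-trivial'' means different from the invariant curves $x=0$ and $a_1(t)x=1$ (neither of which lies in $V$). *)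

(* Defs.v *)
From HB Require Import structures.
From mathcomp Require Import all_boot all_order all_algebra.
From mathcomp Require Import all_classical all_reals all_analysis.

Set Implicit Arguments.
Unset Strict Implicit.
Unset Printing Implicit Defensive.

Import Order.TTheory GRing.Theory Num.Theory.
Import numFieldNormedType.Exports.

Local Open Scope classical_set_scope.
Local Open Scope ring_scope.

(* C^oo at every point of D; meant for open D, so that all the iterated
   derivatives at a point of D depend only on the restriction of f to D. *)
Definition smooth_on (R : realType) (D : set R) (f : R -> R) : Prop :=
  forall (n : nat) (t : R), D t -> derivable (derive1n n f) t 1.

(* a2 and b2 are total functions whose values at the zeros of a1 are
   irrelevant (they may have poles there).  c3, c2, c1 are the smooth extensions
   to R of the coefficients of x^3, x^2, x in the expanded Abel equation; they
   are unique since the zero set of a1, being null, has dense complement. *)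
Record abel_coefficients (R : realType) (T : R) (a1 a2 b2 c3 c2 c1 : R -> R) :
    Prop := {
  a1_smooth : smooth_on setT a1;
  a1_periodic : periodic a1 T;
  a1_zeros_null : lebesgue_measure [set t : R | a1 t = 0] = 0%E;
  a2_smooth : smooth_on [set t | a1 t != 0] a2;
  a2_periodic : forall t, a1 t != 0 -> a2 (t + T) = a2 t;
  b2_smooth : smooth_on [set t | a1 t != 0] b2;
  b2_periodic : forall t, a1 t != 0 -> b2 (t + T) = b2 t;
  a2_not_null : exists t, a1 t != 0 /\ a2 t != 0;
  c3_smooth : smooth_on setT c3;
  c3_periodic : periodic c3 T;
  c3E : forall t, a1 t != 0 -> c3 t = a1 t * a2 t;
  c2_smooth : smooth_on setT c2;
  c2_periodic : periodic c2 T;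
  c2E : forall t, a1 t != 0 -> c2 t = - (a1 t * b2 t + a2 t);
  c1_smooth : smooth_on setT c1;
  c1_periodic : periodic c1 T;
  c1E : forall t, a1 t != 0 -> c1 t = b2 t - derive1 a1 t / a1 t
}.

Definition regionV (R : realType) (a1 : R -> R) : set (R * R) :=
  [set p | [\/ (forall s, 0 < a1 s) /\ 0 < p.2 < (a1 p.1)^-1,
               (exists s, a1 s = 0) /\
                 (0 < p.2 /\ (0 < a1 p.1 -> p.2 < (a1 p.1)^-1))
             | (forall s, a1 s < 0) /\ (0 < p.2 \/ p.2 < (a1 p.1)^-1)]].

(* P ranges over Borel sets; this loses nothing, as a Lebesgue measurable set of
   positive measure contains a Borel set of positive measure. *)
Definition conditionA (R : realType) (T : R) (a1 a2 b2 : R -> R) (eta : R) :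
    Prop :=
  [/\ forall t, t \in `[0, T] -> a1 t != 0 ->
        0 <= b2 t + eta * (derive1 a1 t / a1 t),
      forall t, t \in `[0, T] -> a1 t < 0 -> 0 <= a2 t,
      forall t, t \in `[0, T] -> 0 < a1 t ->
        0 <= a1 t * b2 t - a2 t + eta * derive1 a1 t
    & exists P : set R,
        [/\ P `<=` `[0, T], measurable P, (0 < lebesgue_measure P)%E
          & forall t, P t ->
              (a1 t < 0 -> 0 < a2 t) /\
              (0 < a1 t -> 0 < a1 t * b2 t - a2 t + eta * derive1 a1 t)]].

Definition conditionB (R : realType) (T : R) (a1 a2 b2 : R -> R) (eta : R) :
    Prop :=
  [/\ forall t, t \in `[0, T] -> a1 t != 0 ->
        b2 t + eta * (derive1 a1 t / a1 t) <= 0,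
      forall t, t \in `[0, T] -> a1 t < 0 -> a2 t <= 0,
      forall t, t \in `[0, T] -> 0 < a1 t ->
        a1 t * b2 t - a2 t + eta * derive1 a1 t <= 0
    & exists P : set R,
        [/\ P `<=` `[0, T], measurable P, (0 < lebesgue_measure P)%E
          & forall t, P t ->
              (a1 t < 0 -> a2 t < 0) /\
              (0 < a1 t -> a1 t * b2 t - a2 t + eta * derive1 a1 t < 0)]].

Record abel_hypotheses (R : realType) (T : R) (a1 a2 b2 c3 c2 c1 : R -> R) :
    Prop := {
  hyp_coefficients : abel_coefficients T a1 a2 b2 c3 c2 c1;
  hyp_b2_not_null : exists t, a1 t != 0 /\ b2 t != 0;
  hyp_sign : exists eta, conditionA T a1 a2 b2 eta \/ conditionB T a1 a2 b2 eta
}.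

Definition solution (R : realType) (c3 c2 c1 : R -> R) (u : R -> R) : Prop :=
  forall t : R,
    is_derive t 1 u (c3 t * u t ^+ 3 + c2 t * u t ^+ 2 + c1 t * u t).

(* With T-periodic coefficients, a solution on [0, T] with u(T) = u(0) extends
   to all of R, so considering only globally defined solutions is no loss. *)
Definition periodic_solution (R : realType) (T : R) (c3 c2 c1 : R -> R) :
    set (R -> R) :=
  [set u | solution c3 c2 c1 u /\ u T = u 0].

(* Solutions are identified with their initial values u(0). *)
Definition limit_cycle (R : realType) (T : R) (c3 c2 c1 : R -> R) :
    set (R -> R) :=
  [set u | periodic_solution T c3 c2 c1 u /\
     isolated [set v 0 | v in periodic_solution T c3 c2 c1] (u 0)].

Definition nontrivial_limit_cycle_in_V (R : realType) (T : R)
    (a1 c3 c2 c1 : R -> R) : set (R -> R) :=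
  [set u | [/\ limit_cycle T c3 c2 c1 u,
               ~ (forall t, u t = 0),
               ~ (forall t, a1 t * u t = 1)
             & forall t, regionV a1 (t, u t)]].

(* Main.v *)
(** If [u] and [v] are two positive solutions in [V] then [d = 1/u - 1/v] satisfies
    [d'/d = c3 u v - c1].  Subtracting the logarithmic derivative of
    [|a1|^(1 + eta)] turns the right-hand side into
    [a1 a2 u v - (b2 + eta a1'/a1)], which the hypotheses force to have a
    constant sign, strict somewhere, contradicting periodicity.  The correction
    [|a1|^(1 + eta)] is singular only if [a1] has a zero, but then the sign of
    [b2 + eta a1'/a1] near that zero forces [eta = -1], and no correction is
    needed.  When [a1 < 0], the same argument applied to [1/u - a1] rules out
    periodic solutions below [1/a1]. *)
Require Import Defs.
From mathcomp Require Import all_boot all_order all_algebra.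
From mathcomp Require Import all_classical all_reals all_analysis.
From mathcomp Require Import measurable_realfun ring lra.

Set Implicit Arguments.
Unset Strict Implicit.
Unset Printing Implicit Defensive.

Import Order.TTheory GRing.Theory Num.Theory.
Import numFieldNormedType.Exports.

Local Open Scope classical_set_scope.
Local Open Scope ring_scope.

(** * Calculus on the line: Gronwall estimates, monotone loops, null sets *)

Lemma is_derive_continuous (R : realType) (f : R -> R) (x df : R) :
  is_derive x 1 f df -> {for x, continuous f}.
Proof. by case=> dfx _; exact/differentiable_continuous/derivable1_diffP. Qed.

Lemma smooth_derive (R : realType) (f : R -> R) (t : R) :
  smooth_on setT f -> is_derive t 1 f (derive1 f t).
Proof. by move=> sf; rewrite derive1E; apply: derivableP; exact: (sf 0%N). Qed.

Lemma smooth_continuous (R : realType) (f : R -> R) :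
  smooth_on setT f -> continuous f.
Proof. by move=> sf t; apply: is_derive_continuous; exact: smooth_derive. Qed.

Lemma smooth_continuous_derive1 (R : realType) (f : R -> R) :
  smooth_on setT f -> continuous (derive1 f).
Proof.
move=> sf t; apply: is_derive_continuous.
by apply: derivableP; exact: (sf 1%N).
Qed.

Lemma derive_ge0_le (R : realType) (f df : R -> R) (a b : R) : a <= b ->
  (forall t : R, is_derive t 1 f (df t)) ->
  (forall t : R, t \in `]a, b[ -> 0 <= df t) -> f a <= f b.
Proof.
rewrite le_eqVlt => /predU1P[->//|ab] fdf df0.
have fc : {within `[a, b], continuous f}.
  by apply/continuous_subspaceT => t; exact: is_derive_continuous.
have [c cab fab] := MVT ab (fun t _ => fdf t) fc.
by rewrite -subr_ge0 fab mulr_ge0 ?df0// subr_ge0 ltW.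
Qed.

(** The function [f t * expR (- K * t)] is nonincreasing and starts at [0]. *)
Lemma gronwall_eq0 (R : realType) (f df : R -> R) (K a b : R) : a <= b ->
  (forall t : R, is_derive t 1 f (df t)) ->
  (forall t : R, t \in `]a, b[ -> df t <= K * f t) ->
  f a = 0 -> 0 <= f b -> f b = 0.
Proof.
move=> ab fdf fK fa0 fb0; apply/le_anti; rewrite fb0 andbT.
pose g t := - (f t * expR (- K * t)).
have gdg (t : R) : is_derive t 1 g ((K * f t - df t) * expR (- K * t)).
  have dE : is_derive t 1 (expR \o ( *%R (- K))) (expR (- K * t) * - K).
    apply: is_derive1_comp.
    have := is_deriveM (is_derive_cst (- K) t 1) (is_derive_id t (1 : R)).
    by rewrite !scaler0 addr0 /GRing.scale/= mulr1.
  have dfE := is_deriveM (fdf t) dE.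
  by apply: (is_derive_eq (is_deriveN dfE)); rewrite /GRing.scale/=; ring.
have : g a <= g b.
  apply: (derive_ge0_le ab gdg) => t tab.
  by rewrite mulr_ge0 ?expR_ge0// subr_ge0 fK.
by rewrite /g fa0 mul0r oppr0 oppr_ge0 pmulr_lle0 ?expR_gt0.
Qed.

Lemma is_derive_compN (R : realType) (f : R -> R) (t df : R) :
  is_derive (- t) 1 f df -> is_derive t 1 (f \o -%R) (- df).
Proof.
by move=> fdf; rewrite -mulrN1; exact: is_derive1_comp.
Qed.

Lemma gronwall_eq0_backward (R : realType) (f df : R -> R) (K a b : R) :
  a <= b -> (forall t : R, is_derive t 1 f (df t)) ->
  (forall t : R, t \in `]a, b[ -> - K * f t <= df t) ->
  f b = 0 -> 0 <= f a -> f a = 0.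
Proof.
move=> ab fdf fK fb0 fa0.
have := @gronwall_eq0 _ (f \o -%R) (fun t => - df (- t)) K (- b) (- a).
rewrite /= !opprK; apply => //; first by rewrite lerN2.
- by move=> t; exact: is_derive_compN.
- move=> t; rewrite in_itv/= ltrNl ltrNr => /andP[tb ta].
  by rewrite lerNl -mulNr fK// in_itv/= ta tb.
Qed.

(** Gronwall applied to [z ^+ 2], which is nonnegative and satisfies a linear equation with
    coefficient [2 * q]. This coefficient is bounded between [t0] and [t]: its maximum serves
    forward in time, its minimum backward. *)
Lemma linear_ode_eq0 (R : realType) (z q : R -> R) (t0 : R) : continuous q ->
  (forall t : R, is_derive t 1 z (q t * z t)) -> z t0 = 0 -> forall t, z t = 0.
Proof.
move=> qc dz z0 t.
pose q2 s := 2 * q s.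
have dz2 (s : R) : is_derive s 1 (z ^+ 2) (q2 s * (z ^+ 2) s).
  apply: (is_derive_eq (is_deriveX 2 (dz s))).
  by rewrite /GRing.scale /q2 fctE /=; ring.
have q2c : continuous q2 by move=> s; apply: cvgM; [exact: cvg_cst|exact: qc].
have z20 : (z ^+ 2) t0 = 0 by rewrite fctE z0 expr0n.
suff : (z ^+ 2) t = 0 by rewrite fctE => /eqP; rewrite sqrf_eq0 => /eqP.
have [le|lt] := leP t0 t.
  have [c _ qle] := EVT_max le (continuous_subspaceT q2c).
  apply: (gronwall_eq0 le dz2 _ z20 (sqr_ge0 _)) => s /subset_itv_oo_cc sab.
  by apply: ler_wpM2r; [exact: sqr_ge0|exact: qle].
have [c _ qle] := EVT_min (ltW lt) (continuous_subspaceT q2c).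
apply: (@gronwall_eq0_backward _ _ _ (- q2 c) _ _ (ltW lt) dz2 _ z20
  (sqr_ge0 _)) => s /subset_itv_oo_cc sab.
by rewrite opprK; apply: ler_wpM2r; [exact: sqr_ge0|exact: qle].
Qed.

(** [h] is nondecreasing and takes equal values at both ends, so it is constant in between. *)
Lemma derive_eq0_of_loop (R : realType) (h k : R -> R) (a b : R) :
  (forall t : R, is_derive t 1 h (k t)) ->
  (forall t : R, t \in `]a, b[ -> 0 <= k t) -> h a = h b ->
  forall t : R, t \in `]a, b[ -> k t = 0.
Proof.
move=> hk k0 hab t tab.
have hE : {near t, h =1 cst (h a)}.
  near=> s.
  have : s \in `]a, b[ by near: s; exact: near_in_itvoo.
  rewrite in_itv/= => /andP[as_ sb]; apply/le_anti/andP; split.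
    rewrite /= hab; apply: (derive_ge0_le (ltW sb) hk) => r.
    rewrite in_itv/= => /andP[sr rb].
    by rewrite k0// in_itv/= rb (lt_trans as_ sr).
  apply: (derive_ge0_le (ltW as_) hk) => r.
  rewrite in_itv/= => /andP[ar rs].
  by rewrite k0// in_itv/= ar (lt_trans rs sb).
have [_ ktE] := near_eq_is_derive hE (hk t).
by rewrite -ktE derive_cst.
Unshelve. all: by end_near. Qed.

Lemma measurable_zeros (R : realType) (a : R -> R) :
  continuous a -> measurable [set t | a t = 0].
Proof.
move=> ac; apply: closed_measurable.
by apply: (@preimage_closed _ _ a [set x | x = 0]) => [x _|];
  [exact: ac|exact: closed_eq].
Qed.

(** If [k t < 0], then by continuity [k] is negative on a ball around [t], which must lie in the
    zero set of [a]; but a ball has positive measure. *)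
Lemma ge0_off_null_set (R : realType) (a k : R -> R) (x y : R) :
  continuous a -> lebesgue_measure [set t | a t = 0] = 0%E -> continuous k ->
  (forall t : R, t \in `]x, y[ -> a t != 0 -> 0 <= k t) ->
  forall t : R, t \in `]x, y[ -> 0 <= k t.
Proof.
move=> ac a0 kc k0 t txy; rewrite leNgt; apply/negP => kt.
have : \near t, a t = 0.
  near=> s.
  have sxy : s \in `]x, y[ by near: s; exact: near_in_itvoo.
  have ks : k s < 0 by near: s; exact: (cvgr_lt _ (kc t)).
  by apply/eqP; apply: contraLR ks => as0; rewrite -leNgt k0.
move=> /nbhs_ballP[e /= e0 ea].
have : (lebesgue_measure (ball t e) <= lebesgue_measure [set t | a t = 0%R])%E.
  apply: le_measure; rewrite ?inE//; first exact: measurable_ball.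
  exact: measurable_zeros.
by rewrite leNgt a0 lebesgue_measure_ball ?(ltW e0)// lte_fin mulrn_wgt0.
Unshelve. all: by end_near. Qed.

Lemma smooth_on_cst (R : realType) (D : set R) (c : R) :
  smooth_on D (cst c : R -> R).
Proof.
move=> n t _; suff [d ->] : exists d, derive1n n (cst c : R -> R) = cst d.
  exact: derivable_cst.
elim: n => [|n [d IH]]; first by exists c.
by exists 0; rewrite derive1nS IH; apply/funext => s; exact: derive1_cst.
Qed.

Lemma periodic_zero (R : realType) (a : R -> R) (T s : R) : 0 < T ->
  periodic a T -> a s = 0 -> exists2 t, t \in `[0, T[ & a t = 0.
Proof.
move=> T0 aT as0; pose n := Num.floor (s / T).
have /andP[ns sn] := floor_itv (s / T).
exists (s - n%:~R * T).
  rewrite in_itv/= subr_ge0 -ler_pdivlMr// ns/= ltrBlDr.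
  suff -> : T + n%:~R * T = (n + 1)%:~R * T by rewrite -ltr_pdivrMr.
  by rewrite intrD mulrDl mul1r addrC.
rewrite -as0 mulrzl; case: n {ns sn} => m.
  by rewrite -pmulrn -[LHS](periodicn aT m) subrK.
by rewrite NegzE mulrNz opprK -pmulrn periodicn.
Qed.

(** The loop is [e * (ln (f ^+ 2) - 2 * G)], with derivative [2 * e * (q - g)]. Squaring [f] makes
    the logarithm available for either sign. *)
Lemma derive_log_loop (R : realType) (T e : R) (f q G g : R -> R) : e != 0 ->
  (forall t : R, is_derive t 1 f (q t * f t)) -> (forall t, f t != 0) ->
  (forall t : R, is_derive t 1 G (g t)) -> f T = f 0 -> G T = G 0 ->
  (forall t : R, t \in `]0, T[ -> 0 <= e * (q t - g t)) ->
  forall t : R, t \in `]0, T[ -> q t = g t.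
Proof.
move=> e0 df f0 dG fT GT qg t tT.
pose h s := e * (ln (f s ^+ 2) - 2 * G s).
have dh (s : R) : is_derive s 1 h (2 * (e * (q s - g s))).
  have f20 : 0 < (f ^+ 2) s by rewrite fctE exprn_even_gt0//= f0.
  have dln := is_derive1_comp (is_derive1_ln f20) (is_deriveX 2 (df s)).
  have d2G := is_deriveM (is_derive_cst (2 : R) s 1) (dG s).
  have dh := is_deriveM (is_derive_cst e s 1) (is_deriveB dln d2G).
  apply: (is_derive_eq dh); rewrite /GRing.scale !fctE /=.
  by field; exact: f0.
have h0T : h 0 = h T by rewrite /h fT GT.
have k0 (s : R) : s \in `]0, T[ -> 0 <= 2 * (e * (q s - g s)).
  by move=> sT; rewrite mulr_ge0// qg.
have /eqP := derive_eq0_of_loop dh k0 h0T tT.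
by rewrite mulf_eq0 pnatr_eq0/= mulf_eq0 (negbTE e0)/= subr_eq0 => /eqP.
Qed.

(** * Solutions of the cubic equation: uniqueness, sign, reciprocals *)

Section Solutions.
Context (R : realType) (c3 c2 c1 : R -> R).
Hypotheses (c3c : continuous c3) (c2c : continuous c2) (c1c : continuous c1).

Lemma solution_continuous (u : R -> R) : solution c3 c2 c1 u -> continuous u.
Proof. by move=> su t; exact: is_derive_continuous (su t). Qed.

(** The difference [u - v] solves a linear equation whose coefficient is the divided difference of
    the cubic between [u] and [v]. *)
Lemma solution_unique (u v : R -> R) (t0 : R) : solution c3 c2 c1 u ->
  solution c3 c2 c1 v -> u t0 = v t0 -> u = v.
Proof.
move=> su sv uv0; apply/funext => t; apply/eqP; rewrite -subr_eq0; apply/eqP.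
pose q s := c3 s * (u s * u s + u s * v s + v s * v s) + c2 s * (u s + v s)
  + c1 s.
have uc := solution_continuous su; have vc := solution_continuous sv.
apply: (@linear_ode_eq0 _ (fun t => u t - v t) q t0) => [s|s|].
- by do ![apply: cvgD | apply: cvgM | exact: uc | exact: vc | exact: c3c
    | exact: c2c | exact: c1c].
- by apply: (is_derive_eq (is_deriveB (su s) (sv s))); rewrite /q; ring.
- by rewrite uv0 subrr.
Qed.

Lemma solution0 : solution c3 c2 c1 (cst 0).
Proof.
by move=> t; apply: (is_derive_eq (is_derive_cst 0 t 1)); rewrite /=; ring.
Qed.

(** A change of sign would produce a zero, and uniqueness would then identify [u] with the zero
    solution. *)
Lemma solution_sign (u : R -> R) (s t : R) : solution c3 c2 c1 u ->
  0 < u s -> 0 < u t.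
Proof.
move=> su us; rewrite ltNge; apply/negP => ut.
have uc := solution_continuous su.
have ivt x y : x <= y -> Num.min (u x) (u y) <= 0 <= Num.max (u x) (u y) ->
    exists r, u r = 0.
  move=> xy uxy.
  by have [r _ ur] := IVT xy (continuous_subspaceT uc) uxy; exists r.
have [r ur0] : exists r, u r = 0.
  have [st|/ltW ts] := leP s t.
    by apply: (ivt s t st); rewrite ge_min le_max ut (ltW us) orbT.
  by apply: (ivt t s ts); rewrite ge_min le_max ut (ltW us) orbT.
by move: us; rewrite (solution_unique (t0 := r) su solution0 ur0)/= ltxx.
Qed.

(** In this form [c2] is a free term, so it cancels in the difference of two reciprocals. *)
Lemma solution_inv (u : R -> R) (t : R) : solution c3 c2 c1 u -> u t != 0 ->
  is_derive t 1 (fun s => (u s)^-1) (- (c3 t * u t + c2 t + c1 t / u t)).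
Proof.
move=> su ut0; apply: (is_derive_eq (is_deriveV ut0 (su t))).
by rewrite /GRing.scale/=; field.
Qed.

End Solutions.

(* Conditions (A) and (B), for [e = 1] and [e = -1] respectively. *)
Definition sign_condition (R : realType) (T : R) (a1 a2 b2 : R -> R)
    (eta e : R) : Prop :=
  [/\ e != 0,
      forall t : R, t \in `[0, T] -> a1 t != 0 ->
        0 <= e * (b2 t + eta * (derive1 a1 t / a1 t)),
      forall t : R, t \in `[0, T] -> a1 t < 0 -> 0 <= e * a2 t,
      forall t : R, t \in `[0, T] -> 0 < a1 t ->
        0 <= e * (a1 t * b2 t - a2 t + eta * derive1 a1 t)
    & exists2 t : R, t \in `]0, T[ & [/\ a1 t != 0,
        a1 t < 0 -> 0 < e * a2 t
      & 0 < a1 t -> 0 < e * (a1 t * b2 t - a2 t + eta * derive1 a1 t)]].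

(** Otherwise [P] would be contained in the null set formed by [Z] and the two endpoints. *)
Lemma exists_interior_off_null_set (R : realType) (T : R) (Z P : set R) :
  measurable Z -> lebesgue_measure Z = 0%E -> P `<=` `[0, T] ->
  measurable P -> (0 < lebesgue_measure P)%E ->
  exists t, [/\ P t, t \in `]0, T[ & ~ Z t].
Proof.
move=> mZ Z0 PT mP; apply: contraPP => noP; apply/negP; rewrite -leNgt.
have PS : P `<=` Z `|` ([set 0] `|` [set T]).
  move=> t Pt; have [Zt|nZt] := pselect (Z t); [by left|right].
  apply: contrapT => /not_orP[/eqP t0 /eqP tT]; apply: noP; exists t; split=> //.
  have := PT _ Pt; rewrite /= !in_itv/= !lt_neqAle => /andP[-> ->].
  by rewrite tT eq_sym t0.
have m0T : measurable ([set 0] `|` [set T] : set R).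
  by apply: measurableU; exact: measurable_set1.
have mU : measurable (Z `|` ([set 0] `|` [set T])) by exact: measurableU.
have PU : (lebesgue_measure P <=
    lebesgue_measure (Z `|` ([set 0%R] `|` [set T])))%E.
  by apply: le_measure; rewrite ?inE.
have mU2 (A B : set R) : measurable A -> measurable B ->
    (lebesgue_measure (A `|` B) <= lebesgue_measure A + lebesgue_measure B)%E.
  exact: (measureU2 (@lebesgue_measure R)).
apply: (le_trans PU); apply: (le_trans (mU2 _ _ mZ m0T)).
rewrite [X in (X + _)%E]Z0 add0e; apply: (le_trans (mU2 _ _ _ _)).
- exact: measurable_set1.
- exact: measurable_set1.
- by rewrite !lebesgue_measure_set1 add0e.
Qed.

(** * Sign conditions, the logarithmic correction, and uniqueness *)

Section UpperBound.
Context (R : realType) (T : R) (a1 a2 b2 c3 c2 c1 : R -> R) (eta e : R).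
Hypotheses (T_gt0 : 0 < T).
Hypothesis coef : abel_coefficients T a1 a2 b2 c3 c2 c1.

Let a1c : continuous a1 := smooth_continuous (a1_smooth coef).
Let c3c : continuous c3 := smooth_continuous (c3_smooth coef).
Let c2c : continuous c2 := smooth_continuous (c2_smooth coef).
Let c1c : continuous c1 := smooth_continuous (c1_smooth coef).
Let da1 (t : R) : is_derive t 1 a1 (derive1 a1 t) :=
  smooth_derive t (a1_smooth coef).

(** A single interior point with strict inequalities can replace [P], because the loop argument
    forces equality at every interior point. *)
Lemma condition_sign : conditionA T a1 a2 b2 eta \/ conditionB T a1 a2 b2 eta ->
  exists e, sign_condition T a1 a2 b2 eta e.
Proof.
case=> -[h1 h2 h3 [P [PT mP P0 hP]]];
  have [t [Pt tT /eqP at0]] := exists_interior_off_null_set (measurable_zeros a1c)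
    (a1_zeros_null coef) PT mP P0; have [hn hp] := hP _ Pt.
- exists 1; split; rewrite ?oner_neq0// => *.
  + by rewrite mul1r h1.
  + by rewrite mul1r h2.
  + by rewrite mul1r h3.
  + by exists t => //; rewrite !mul1r.
- exists (-1); split; rewrite ?oppr_eq0 ?oner_neq0// => *.
  + by rewrite mulN1r oppr_ge0 h1.
  + by rewrite mulN1r oppr_ge0 h2.
  + by rewrite mulN1r oppr_ge0 h3.
  + by exists t => //; rewrite !mulN1r !oppr_gt0.
Qed.

Hypothesis sc : sign_condition T a1 a2 b2 eta e.

(** On such an interval the constant [-1] would be vacuously nonnegative off the zeros of [a1],
    hence nonnegative by [ge0_off_null_set]. *)
Lemma a1_not_null (x y : R) : x < y ->
  (forall t : R, t \in `]x, y[ -> a1 t = 0) -> False.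
Proof.
move=> xy a10.
have kc : continuous (cst (-1) : R -> R) by move=> t; exact: cvg_cst.
have mid : (x + y) / 2 \in `]x, y[ by rewrite in_itv/= !midf_lt.
have := ge0_off_null_set a1c (a1_zeros_null coef) kc _ mid.
rewrite /= oppr_ge0 ler10 => /(_ _)/negP; apply => // t /a10 ->.
by rewrite eqxx.
Qed.

(* [b2 - a1'/a1] is bounded, so unless [eta = -1] the sign of
   [b2 + eta a1'/a1] bounds [(ln a1^2)'] on one side, which prevents [a1^2] from
   leaving, or from reaching, the value zero. *)
Lemma eta_eqN1 : (exists s, a1 s = 0) -> eta = -1.
Proof.
move=> [s /(periodic_zero T_gt0 (a1_periodic coef))[z]].
rewrite in_itv/= => /andP[z0 zT] az.
have [e0 hb _ _ _] := sc.
pose k := e * (1 + eta).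
have ec1c : continuous (fun t => e * c1 t).
  by move=> t; apply: cvgM; [exact: cvg_cst|exact: c1c].
have [m _ hm] := EVT_max (ltW T_gt0) (continuous_subspaceT ec1c).
pose M := e * c1 m.
(* Subtracting [e * c1 t <= M] from the sign condition gives [k * (a1' / a1) >= - M]. Multiplying by
   [a1 ^+ 2] yields a form that also holds at the zeros of [a1]. *)
have kM (t : R) : t \in `[0, T] -> - M * a1 t ^+ 2 <= k * (a1 t * derive1 a1 t).
  move=> tT; have [->|at0] := eqVneq (a1 t) 0.
    by rewrite expr0n/= mulr0 mul0r mulr0.
  have := hb t tT at0; have := hm t tT; rewrite (c1E coef)// => hM hbt.
  have -> : k * (a1 t * derive1 a1 t) =
      a1 t ^+ 2 * (e * (b2 t + eta * (derive1 a1 t / a1 t))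
        - e * (b2 t - derive1 a1 t / a1 t)).
    by rewrite /k; field.
  rewrite mulrC; apply: ler_wpM2l; first exact: sqr_ge0.
  by rewrite lerBrDl (le_trans _ hbt)// subr_le0.
have da2 (t : R) : is_derive t 1 (a1 ^+ 2) (2 * (a1 t * derive1 a1 t)).
  apply: (is_derive_eq (is_deriveX 2 (da1 t))).
  by rewrite /GRing.scale/=; ring.
apply/eqP; rewrite -subr_eq0 opprK addrC; apply: contraT => eta1.
have k_neq0 : k != 0 by rewrite mulf_neq0.
(* Dividing by [k] bounds the derivative of [a1 ^+ 2] from above if [k < 0] and from below if
   [k > 0]. The zero then spreads forward to [T] or backward to [0], respectively. *)
move: (k_neq0); rewrite neq_lt => /orP[k0|k0].
- exfalso; apply: (@a1_not_null z T zT) => t; rewrite in_itv/= => /andP[zt tT].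
  suff : (a1 ^+ 2) t = 0 by rewrite fctE => /eqP; rewrite sqrf_eq0 => /eqP.
  apply: (@gronwall_eq0 _ _ _ (- (2 * M) / k) _ _ (ltW zt) da2) => [r||].
  + rewrite in_itv/= => /andP[zr rt].
    have /kM kMr : r \in `[0, T].
      by rewrite in_itv/= (le_trans z0 (ltW zr)) (ltW (lt_trans rt tT)).
    by rewrite fctE/= (mulrAC (- _)) ler_ndivlMr//; lra.
  + by rewrite fctE az expr0n.
  + exact: sqr_ge0.
(* The backward argument needs a zero in []0, T]]; when [z = 0], periodicity moves it to [T]. *)
- pose z1 := if z == 0 then T else z.
  have [z1_gt0 z1T az1] : [/\ 0 < z1, z1 <= T & a1 z1 = 0].
    rewrite /z1; have [z00|z00] := eqVneq z 0.
      by split=> //; rewrite -az z00 -[in LHS](add0r T) (a1_periodic coef).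
    by split=> //; [rewrite lt_neqAle eq_sym z00|exact: ltW].
  exfalso; apply: (@a1_not_null 0 z1 z1_gt0) => t.
  rewrite in_itv/= => /andP[t0 tz].
  suff : (a1 ^+ 2) t = 0 by rewrite fctE => /eqP; rewrite sqrf_eq0 => /eqP.
  apply: (@gronwall_eq0_backward _ _ _ (2 * M / k) _ _ (ltW tz) da2) => [r||].
  + rewrite in_itv/= => /andP[tr rz].
    have /kM kMr : r \in `[0, T].
      by rewrite in_itv/= (ltW (lt_trans t0 tr)) (le_trans (ltW rz) z1T).
    by rewrite fctE/= -(ler_pM2l k0) [leLHS]mulrA mulrN [k * (_ / k)]mulrCA divff//
      mulr1; lra.
  + by rewrite fctE az1 expr0n.
  + exact: sqr_ge0.
Qed.

(* [G] is a primitive of [(1 + eta) a1'/a1]: it vanishes when [eta = -1], and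
   is [(1 + eta) ln |a1|] when [a1] has no zero. *)
Lemma exists_log_correction : exists G g : R -> R,
  [/\ forall t : R, is_derive t 1 G (g t), continuous g, G T = G 0
    & forall t, a1 t != 0 -> g t = (1 + eta) * (derive1 a1 t / a1 t)].
Proof.
have [zeros|nozeros] := pselect (exists s, a1 s = 0).
  exists (cst 0), (cst 0); split=> // [t|t|t _]; [exact: is_derive_cst|exact: cvg_cst|].
  by rewrite (eta_eqN1 zeros) subrr mul0r.
have a10 t : a1 t != 0 by apply/eqP => at0; apply: nozeros; exists t.
(* Half of [ln (a1 ^+ 2)] is [ln |a1|], whatever the sign of [a1]. *)
exists (fun t => (1 + eta) / 2 * ln (a1 t ^+ 2)).
exists (fun t => (1 + eta) * (derive1 a1 t / a1 t)).
split=> // [t|t|].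
- have f20 : 0 < (a1 ^+ 2) t by rewrite fctE exprn_even_gt0//= a10.
  have dln := is_derive1_comp (is_derive1_ln f20) (is_deriveX 2 (da1 t)).
  apply: (is_derive_eq (is_deriveM (is_derive_cst ((1 + eta) / 2) t 1) dln)).
  by rewrite /GRing.scale !fctE /=; field; exact: a10.
- apply: cvgM; first exact: cvg_cst.
  apply: cvgM; last by apply: cvgV; [exact: a10|exact: a1c].
  exact: (smooth_continuous_derive1 (a1_smooth coef)).
- by rewrite -{1}(add0r T) (a1_periodic coef).
Qed.

(* With d = 1/u - 1/v and G, g as in exists_log_correction,
   (ln |d| - G)' = a1 a2 u v - (b2 + eta a1'/a1), which has the sign of -e: this
   is termwise when a1 < 0, and when a1 > 0 it equals
   (b2 + eta a1'/a1) (a1^2 u v - 1) - a1 u v (a1 (b2 + eta a1'/a1) - a2). *)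
Lemma positive_periodic_unique (u v : R -> R) :
  periodic_solution T c3 c2 c1 u -> periodic_solution T c3 c2 c1 v ->
  (forall t, 0 < u t) -> (forall t, 0 < v t) ->
  (forall t, 0 < a1 t -> a1 t * u t < 1) ->
  (forall t, 0 < a1 t -> a1 t * v t < 1) -> u = v.
Proof.
move=> [su uT] [sv vT] u0 v0 u1 v1.
have [e0 hb hn hp [t0 t0T [at0 hn0 hp0]]] := sc.
have [G [g [dG gc GT gE]]] := exists_log_correction.
have [//|uv] := pselect (u = v).
pose d t := (u t)^-1 - (v t)^-1.
pose q t := c3 t * (u t * v t) - c1 t.
have dd (t : R) : is_derive t 1 d (q t * d t).
  have un0 := lt0r_neq0 (u0 t); have vn0 := lt0r_neq0 (v0 t).
  apply: (is_derive_eq (is_deriveB (solution_inv su un0) (solution_inv sv vn0))).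
  by rewrite /q /d; field; rewrite vn0.
have dn0 t : d t != 0.
  rewrite subr_eq0; apply: contra_not_neq uv => /invr_inj.
  exact: (solution_unique c3c c2c c1c su sv).
have dT : d T = d 0 by rewrite /d uT vT.
have sub_oc (t : R) : t \in `]0, T[ -> t \in `[0, T].
  by rewrite !in_itv/= => /andP[/ltW -> /ltW ->].
have qgE t : a1 t != 0 -> - e * (q t - g t) =
    e * (b2 t + eta * (derive1 a1 t / a1 t)) - a1 t * (u t * v t) * (e * a2 t).
  by move=> at_; rewrite /q gE// (c3E coef)// (c1E coef)//; ring.
have qgE1 t : a1 t != 0 -> - e * (q t - g t) =
    e * (b2 t + eta * (derive1 a1 t / a1 t)) * (1 - a1 t * u t * (a1 t * v t))
    + a1 t * (u t * v t) * (e * (a1 t * b2 t - a2 t + eta * derive1 a1 t)).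
  by move=> at_; rewrite qgE//; field.
have uv0 t : 0 < u t * v t by rewrite mulr_gt0.
have auv1 t : 0 < a1 t -> 0 <= 1 - a1 t * u t * (a1 t * v t).
  move=> at_; rewrite subr_ge0 mulr_ile1 ?mulr_ge0 ?(ltW at_) ?(ltW (u0 t))
    ?(ltW (v0 t))//; by [rewrite ltW ?u1|rewrite ltW ?v1].
(* The sign is computed where [a1] does not vanish; since [q - g] is continuous, it extends across
   the null set of zeros. *)
have k0 (t : R) : t \in `]0, T[ -> 0 <= - e * (q t - g t).
  apply: (@ge0_off_null_set _ _ (fun t => - e * (q t - g t)) _ _ a1c
    (a1_zeros_null coef)) => [s|s /sub_oc sT as0].
    have uc := solution_continuous su; have vc := solution_continuous sv.
    by do ![apply: cvgD | apply: cvgN | apply: cvgM | exact: uc | exact: vc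
      | exact: c3c | exact: c1c | exact: gc | exact: cvg_cst].
  move: (as0); rewrite neq_lt => /orP[as_|as_].
    rewrite qgE// subr_ge0 (le_trans _ (hb _ sT as0))//.
    by rewrite mulr_le0_ge0 ?hn// pmulr_lle0// ltW.
  by rewrite qgE1// addr_ge0// mulr_ge0 ?hb ?auv1 ?hp// mulr_ge0// ltW.
have en0 : - e != 0 by rewrite oppr_eq0.
have q0 := derive_log_loop en0 dd dn0 dG dT GT k0 t0T.
have : - e * (q t0 - g t0) = 0 by rewrite q0 subrr mulr0.
have tT := sub_oc _ t0T.
move=> /eqP; rewrite gt_eqF//; move: (at0); rewrite neq_lt => /orP[at_|at_].
  rewrite qgE// subr_gt0 (lt_le_trans _ (hb _ tT at0))//.
  by rewrite nmulr_rlt0 ?hn0// pmulr_llt0.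
rewrite qgE1// addrC ltr_wpDr//; first by rewrite mulr_ge0 ?hb ?auv1.
by rewrite mulr_gt0 ?hp0// mulr_gt0.
Qed.

(* With w = 1/u - a1, (ln |w| - G)' = a2 u - (b2 + eta a1'/a1). *)
Lemma no_negative_periodic (u : R -> R) : (forall t, a1 t < 0) ->
  periodic_solution T c3 c2 c1 u -> (forall t, u t < (a1 t)^-1) -> False.
Proof.
move=> an [su uT] ua.
have [e0 hb hn _ [t0 t0T [_ hn0 _]]] := sc.
have [G [g [dG _ GT gE]]] := exists_log_correction.
have u0 t : u t < 0 by rewrite (lt_trans (ua t))// invr_lt0.
have aN0 t : a1 t != 0 by rewrite lt_eqF.
pose w t := (u t)^-1 - a1 t.
pose q t := a2 t * u t - b2 t + derive1 a1 t / a1 t.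
have dw (t : R) : is_derive t 1 w (q t * w t).
  have un0 := ltr0_neq0 (u0 t).
  apply: (is_derive_eq (is_deriveB (solution_inv su un0) (da1 t))).
  rewrite /q /w (c3E coef)// (c2E coef)// (c1E coef)//.
  by field; rewrite un0 aN0.
have wn0 t : w t != 0.
  rewrite subr_eq0; apply/eqP => uat; have := ua t.
  by rewrite -uat invrK ltxx.
have wT : w T = w 0.
  by rewrite /w uT -[in LHS](add0r T) (a1_periodic coef).
have qgE t : - e * (q t - g t) =
    e * (b2 t + eta * (derive1 a1 t / a1 t)) - u t * (e * a2 t).
  by rewrite /q gE//; ring.
have sub_oc (t : R) : t \in `]0, T[ -> t \in `[0, T].
  by rewrite !in_itv/= => /andP[/ltW -> /ltW ->].
have k0 (t : R) : t \in `]0, T[ -> 0 <= - e * (q t - g t).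
  move=> /sub_oc tT; rewrite qgE subr_ge0 (le_trans _ (hb _ tT _))//.
  by rewrite mulr_le0_ge0 ?hn// ltW.
have en0 : - e != 0 by rewrite oppr_eq0.
have q0 := derive_log_loop en0 dw wn0 dG wT GT k0 t0T.
have : - e * (q t0 - g t0) = 0 by rewrite q0 subrr mulr0.
move=> /eqP; rewrite gt_eqF// qgE subr_gt0.
by rewrite (lt_le_trans _ (hb _ (sub_oc _ t0T) _))// nmulr_rlt0 ?hn0.
Qed.

(** Only when [a1 < 0] everywhere does [V] have points with negative second coordinate. Then
    [no_negative_periodic] gives [u] a positive value somewhere, and [solution_sign] propagates
    it. *)
Lemma regionV_positive (u : R -> R) : periodic_solution T c3 c2 c1 u ->
  (forall t, regionV a1 (t, u t)) ->
  (forall t, 0 < u t) /\ (forall t, 0 < a1 t -> a1 t * u t < 1).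
Proof.
move=> pu uV; have [su _] := pu.
have lt1 t : 0 < a1 t -> u t < (a1 t)^-1 -> a1 t * u t < 1.
  by move=> at_; rewrite -ltr_pdivlMl// mulr1.
have [an|nan] := pselect (forall s, a1 s < 0).
  suff u0 : exists s, 0 < u s.
    split=> t; last by rewrite ltNge (ltW (an t)).
    by have [s us] := u0; exact: (solution_sign c3c c2c c1c t su us).
  apply: contrapT => nu0; apply: (no_negative_periodic an pu) => t.
  have [[ap _]|[[s as0] _]|[_ /=[ut|//]]] := uV t.
  - by have := lt_trans (ap t) (an t); rewrite ltxx.
  - by have := an s; rewrite as0 ltxx.
  - by case: nu0; exists t.
split=> t.
- by have [[_ /andP[]]|[_ []]|[]] := uV t.
- by move=> at_; apply: lt1 => //; have [[_ /andP[]]|[_ [_ /=->]]|[]] := uV t.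
Qed.

End UpperBound.

(** * The upper bound and an example attaining it *)

(** Stated for periodic solutions rather than limit cycles, so that it also proves the isolation of
    the cycle in the example. *)
Lemma periodic_in_regionV_unique (R : realType) (T : R)
    (a1 a2 b2 c3 c2 c1 : R -> R) (u v : R -> R) : 0 < T ->
  abel_hypotheses T a1 a2 b2 c3 c2 c1 ->
  periodic_solution T c3 c2 c1 u -> (forall t, regionV a1 (t, u t)) ->
  periodic_solution T c3 c2 c1 v -> (forall t, regionV a1 (t, v t)) -> u = v.
Proof.
move=> T0 [coef _ [eta /(condition_sign coef)[e sc]]] pu uV pv vV.
have [u0 u1] := regionV_positive T0 coef sc pu uV.
have [v0 v1] := regionV_positive T0 coef sc pv vV.
exact: (positive_periodic_unique T0 coef sc pu pv).
Qed.

(* The equation is x' = x - x^3, with limit cycle x = 1. *)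
Lemma example_hypotheses (R : realType) (T : R) : 0 < T ->
  abel_hypotheses T (cst (-1)) (cst 1) (cst 1) (cst (-1)) (cst 0) (cst 1).
Proof.
move=> T0; have n10 : -1 != 0 :> R by rewrite oppr_eq0 oner_eq0.
split; first split; try (by move=> *; exact: smooth_on_cst); try by [].
- rewrite (_ : [set _ | _] = set0) ?measure0//.
  by apply/seteqP; split=> t //= /eqP; rewrite (negbTE n10).
- by exists 0; rewrite oner_eq0.
- by move=> t _; rewrite /=; ring.
- by move=> t _; rewrite /=; ring.
- by move=> t _; rewrite derive1_cst mul0r subr0.
- by exists 0; rewrite oner_eq0.
- exists 0; left; split=> [t _ _|t _ _|t _ /=|].
  + by rewrite mul0r addr0.
  + exact: ler01.
  + by rewrite oppr_gt0 ltr10.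
  + exists `[0, T]%classic; split=> //; last first.
      by move=> t _; split=> [_|/=]; rewrite ?ltr01// oppr_gt0 ltr10.
    by rewrite lebesgue_measure_itv/= lte_fin T0 oppr0 adde0 lte_fin.
Qed.

Lemma example_limit_cycle (R : realType) (T : R) : 0 < T ->
  nontrivial_limit_cycle_in_V T (cst (-1)) (cst (-1)) (cst 0) (cst 1)
    (cst 1 : R -> R).
Proof.
move=> T0.
have cc (c : R) : continuous (cst c : R -> R) by move=> t; exact: cvg_cst.
have s1 : periodic_solution T (cst (-1)) (cst 0) (cst 1) (cst 1 : R -> R).
  by split=> // t; apply: (is_derive_eq (is_derive_cst (1 : R) t 1)) => /=; ring.
have V (u : R -> R) : (forall t, 0 < u t) ->
    forall t, regionV (cst (-1)) (t, u t).
  by move=> u0 t; apply: Or33; split=> [s|]; [exact: ltrN10|left; exact: u0].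
have V1 := V (cst 1) (fun=> ltr01).
split=> //; first split=> //.
- split; first by apply/mem_set; exists (cst 1).
  (* A periodic solution with positive initial value stays positive, hence lies in [V] as [a1] is
     negative; uniqueness in [V] makes it the constant [1]. *)
  exists [set x | 0 < x]; first exact: lt_nbhsr.
  apply/seteqP; split=> [r [/= r0 [v pv vr]]|_ ->]; last first.
    by split; [exact: ltr01|exists (cst 1)].
  rewrite -vr in r0 *; have v0 t : 0 < v t.
    exact: (solution_sign (cc _) (cc _) (cc _) t (proj1 pv) r0).
  by rewrite (periodic_in_regionV_unique T0 (example_hypotheses T0) pv (V _ v0)
    s1 V1).
- by move=> /(_ 0)/eqP; rewrite oner_eq0.
- by move=> /(_ 0)/eqP; rewrite mulr1 lt_eqF// (lt_trans _ ltr01)// oppr_lt0.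
Qed.

Theorem theorem1p3 (R : realType) (T : R) (T_gt0 : 0 < T) :
  (forall a1 a2 b2 c3 c2 c1 : R -> R,
     abel_hypotheses T a1 a2 b2 c3 c2 c1 ->
     is_subset1 (nontrivial_limit_cycle_in_V T a1 c3 c2 c1)) /\
  (exists a1 a2 b2 c3 c2 c1 : R -> R,
     abel_hypotheses T a1 a2 b2 c3 c2 c1 /\
     exists! u : R -> R, nontrivial_limit_cycle_in_V T a1 c3 c2 c1 u).
Proof.
have uniq (a1 a2 b2 c3 c2 c1 : R -> R) : abel_hypotheses T a1 a2 b2 c3 c2 c1 ->
    is_subset1 (nontrivial_limit_cycle_in_V T a1 c3 c2 c1).
  move=> hyp u v [[pu _] _ _ uV] [[pv _] _ _ vV].
  exact: (periodic_in_regionV_unique T_gt0 hyp pu uV pv vV).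
split=> //; exists (cst (-1)), (cst 1), (cst 1), (cst (-1)), (cst 0), (cst 1).
have hyp := example_hypotheses T_gt0; have cyc := example_limit_cycle T_gt0.
by split=> //; exists (cst 1); split=> // v; exact: (uniq _ _ _ _ _ _ hyp).
Qed.
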